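(* Let $X,Y\subseteq\mathsf{all}$ be such that $X\neq\emptyset$ and for all $x\in X$ there is $y\in Y$ with $y\ne x$. Assume $0\notin X$ and $1\notin X$. Also assume \begin{enumerate} \item either $0\in Y$ and $1\in Y$, \item or $\mathsf{osc}\notin X$ and there is a number $r\in(0,1]$ such that for all $x\in X$, both $r+x(1-r)$ and $x(1-r)$ belong to $Y$. \end{enumerate} Then $(D_X,\mathrm{Sym}(\omega),R_Y)\le_T([\omega]^\omega,[\omega]^\omega,U\!R)$.
   Context: Relational systems: a relational system is a triple $\mathcal A=(A_-,A_+,A)$ with $A\subseteq A_-\times A_+$ such that for every $a_-\in A_-$ there is $a_+\in A_+$ with $a_-\,A\,a_+$, and for every $a_+\in A_+$ there is $a_-\in A_-$ for which $a_-\,A\,a_+$ fails. $\mathcal A\le_T\mathcal B$ (Tukey reducibility), for $\mathcal B=(B_-,B_+,B)$, means that there are functions $\varphi_-:A_-\to B_-$ and $\varphi_+:B_+\to A_+$ such that for all $a_-\in A_-$, $b_+\in B_+$: $\varphi_-(a_-)\,B\,b_+$ implies $a_-\,A\,\varphi_+(b_+)$. Density: $n\in\omega$ is identified with $\{0,\dots,n-1\}$. For $A\subseteq\omega$, $\underline d(A)=\liminf_n|A\cap n|/n$ and $\overline d(A)=\limsup_n|A\cap n|/n$; if they are equal, $d(A)$ denotes the common value; if $\underline d(A)<\overline d(A)$, write $d(A)=\mathsf{osc}$, where $\mathsf{osc}$ is a formal symbol. $\mathsf{all}=[0,1]\cup\{\mathsf{osc}\}$. $\mathrm{Sym}(\omega)$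 is the set of permutations of $\omega$. $D_X$ is the collection of infinite-coinfinite sets $A\subseteq\omega$ with $d(A)\in X$. For $A\in D_X$ and $\pi\in\mathrm{Sym}(\omega)$, $A\,R_Y\,\pi$ means $d(\pi[A])\in Y$ and $d(\pi[A])\ne d(A)$. $[\omega]^\omega$ is the set of infinite subsets of $\omega$; for $A,B\in[\omega]^\omega$, $A\;U\!R\;B$ means that $B\subseteq^*A$ (i.e. $B\setminus A$ is finite) or $B\cap A$ is finite. *)

(* Defs.v *)
From mathcomp Require Import all_boot all_order all_algebra finmap.
From mathcomp Require Import all_classical all_reals all_analysis.
From mathcomp Require Import zify ring lra.

Set Implicit Arguments.
Unset Strict Implicit.
Unset Printing Implicit Defensive.

Import Order.TTheory GRing.Theory Num.Theory.
Import numFieldNormedType.Exports.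

Local Open Scope classical_set_scope.
Local Open Scope ring_scope.

Record relational_system : Type := RelationalSystem {
  rs_minus : Type;
  rs_plus : Type;
  rs_rel : rs_minus -> rs_plus -> Prop;
  rs_total : forall a : rs_minus, exists b : rs_plus, rs_rel a b;
  rs_unbounded : forall b : rs_plus, exists a : rs_minus, ~ rs_rel a b
}.

Definition tukey_le (A B : relational_system) : Prop :=
  exists (f : rs_minus A -> rs_minus B) (g : rs_plus B -> rs_plus A),
  forall (a : rs_minus A) (b : rs_plus B), rs_rel (f a) b -> rs_rel a (g b).

Notation "A <=T B" := (tukey_le A B) (at level 70, no associativity).

Inductive density_value (R : Type) : Type :=
| Dens of R
| Osc.
Arguments Dens {R}.
Arguments Osc {R}.

Section density.
Context {R : realType}.
Implicit Types (A : set nat).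

(* |A `&` n| / n with n = {0, ..., n - 1}; the value 0 / 0 = 0 at n = 0 does not
   affect the limits inferior and superior. *)
Definition rel_freq A : R^nat :=
  fun n => (#|` fset_set (A `&` `I_n)|%fset)%:R / n%:R.

Definition lower_density A : R := limn_inf (rel_freq A).
Definition upper_density A : R := limn_sup (rel_freq A).

(* Relative frequencies lie in [0, 1], so the lower density is always at most the
   upper one, and they differ exactly when the lower one is smaller. *)
Definition density A : density_value R :=
  if lower_density A == upper_density A then Dens (lower_density A) else Osc.

Definition all_densities : set (density_value R) :=
  [set Dens r | r in `[0, 1]%classic] `|` [set Osc].

End density.

Definition Sym : Type := {p : nat -> nat | bijective p}.

Definition density_set (R : realType) (X : set (density_value R)) : Type :=
  {A : set nat | [/\ infinite_set A, infinite_set (~` A) & X (density A)]}.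

Definition density_rel (R : realType) (X Y : set (density_value R))
    (A : density_set X) (p : Sym) : Prop :=
  Y (density (sval p @` sval A)) /\
  density (sval p @` sval A) <> density (sval A) :> density_value R.

Definition infinite_subset : Type := {A : set nat | infinite_set A}.

Definition ur_rel (A B : infinite_subset) : Prop :=
  finite_set (sval B `\` sval A) \/ finite_set (sval B `&` sval A).

(* The remaining results serve to prove that the triples (D_X, Sym, R_Y) and
   ([omega]^omega, [omega]^omega, UR) satisfy the two axioms of relational
   systems.  In [hits] and [avg], [s] is the inverse of a permutation [p], so
   that [avg s A] is the sequence of relative frequencies of [p @` A]. *)
Section density_lemmas.
Context {R : realType}.
Implicit Types (A : set nat) (s p : nat -> nat) (x : R).

Definition hits s A (n : nat) : nat := (\sum_(j < n) `[< A (s j) >])%N.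
Definition avg s A : R^nat := fun n => (hits s A n)%:R / n%:R.

Lemma rel_freqE A : rel_freq A = avg id A.
Proof.
apply/funext => n; rewrite /rel_freq /avg; congr (_%:R / _).
rewrite /hits; elim: n => [|n IH].
  by rewrite big_ord0 II0 setI0 fset_set0 cardfs0.
have fin : finite_set (A `&` `I_n) by apply: sub_finite_set (finite_II n).
rewrite big_ord_recr /= -IH IIS setIUr.
case: asboolP => An.
  rewrite (_ : A `&` [set n] = [set n]); last by apply/seteqP; split => [? []//|? ->].
  rewrite setUC fset_setU1// cardfsU1 in_fset_set// addnC; congr (_ + _)%N.
  suff -> : n \notin A `&` `I_n by [].
  by rewrite notin_setE => -[_ /=]; rewrite ltnn.
rewrite (_ : A `&` [set n] = set0) ?setU0 ?addn0//.
by apply/seteqP; split => // ? [+ e]; rewrite e.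
Qed.

Lemma avg_ge0 s A n : 0 <= avg s A n :> R.
Proof. by rewrite divr_ge0. Qed.

Lemma hits_le s A n : (hits s A n <= n)%N.
Proof.
rewrite /hits -[leqRHS]card_ord -sum1_card; apply: leq_sum => i _.
by case: asboolP.
Qed.

Lemma avg_le1 s A n : avg s A n <= 1 :> R.
Proof.
rewrite /avg; case: n => [|n]; first by rewrite invr0 mulr0.
by rewrite ler_pdivrMr// mul1r ler_nat hits_le.
Qed.

Lemma hitsC s A n : (hits s A n + hits s (~` A) n)%N = n.
Proof.
rewrite /hits -big_split/= -[RHS]card_ord -sum1_card; apply: eq_bigr => i _.
by rewrite asbool_neg; case: asboolP.
Qed.

Lemma avgC s A n : (0 < n)%N -> avg s (~` A) n = 1 - avg s A n :> R.
Proof.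
move=> n0; rewrite /avg; have /(congr1 (fun k => k%:R : R)) := hitsC s A n.
rewrite natrD => /(canRL (addKr _)) ->.
rewrite mulrDl divff ?mulNr ?pnatr_eq0 -?lt0n// addrC//.
Qed.

Lemma cvg_avgC s A x :
  (avg s A : R^nat) @ \oo --> x -> (avg s (~` A) : R^nat) @ \oo --> 1 - x.
Proof.
move=> h; have : (fun n => 1 - avg s A n) @ \oo --> 1 - x.
  by apply: cvgB => //; exact: cvg_cst.
apply: cvg_trans; apply: near_eq_cvg; near=> n; rewrite avgC//.
by near: n; exact: nbhs_infty_gt.
Unshelve. all: by end_near. Qed.

Lemma density_cvg A x : rel_freq A @ \oo --> x -> density A = Dens x.
Proof.
move=> /cvg_limn_inf_sup[h1 h2].
by rewrite /density /lower_density /upper_density h1 h2 eqxx.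
Qed.

Lemma density_osc A :
  (forall N, exists2 n, (N <= n)%N & rel_freq A n <= 4^-1 :> R) ->
  (forall N, exists2 n, (N <= n)%N & 3 / 4 <= rel_freq A n :> R) ->
  density A = Osc :> density_value R.
Proof.
have ub : ubound (range (rel_freq A : R^nat)) 1.
  by move=> _ [n _ <-]; rewrite rel_freqE avg_le1.
have lb : lbound (range (rel_freq A : R^nat)) 0.
  by move=> _ [n _ <-]; rewrite rel_freqE avg_ge0.
have lub : has_ubound (range (rel_freq A : R^nat)) by exists 1.
have llb : has_lbound (range (rel_freq A : R^nat)) by exists 0.
move=> hl hu; rewrite /density; case: eqP => // e; exfalso.
have : lower_density A <= 4^-1 :> R.
  rewrite /lower_density /limn_inf (cvg_lim _ (cvg_infs_sup lub llb))//.
  apply: ge_sup; first by exists (infs (rel_freq A) 0%N), 0%N.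
  move=> _ [N _ <-]; have [n Nn] := hl N; apply: le_trans.
  apply: ge_inf; last by exists n.
  exact: has_lbound_sdrop.
rewrite e; apply/negP; rewrite -ltNge; apply: (@lt_le_trans _ _ (3/4)).
  lra.
rewrite /upper_density /limn_sup (cvg_lim _ (cvg_sups_inf lub llb))//.
apply: lb_le_inf; first by exists (sups (rel_freq A) 0%N), 0%N.
move=> _ [N _ <-]; have [n Nn] := hu N; move=> /le_trans; apply.
apply: ub_le_sup; last by exists n.
exact: has_ubound_sdrop.
Qed.

Lemma rel_freq_image s p A : cancel s p -> cancel p s ->
  rel_freq (p @` A) = avg s A :> R^nat.
Proof.
move=> sp ps; rewrite rel_freqE; apply/funext => n; rewrite /avg /hits.
congr (_%:R / _); apply: eq_bigr => i _; congr (nat_of_bool _).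
apply: asbool_equiv_eq; split => [[a Aa <-]|As]; first by rewrite ps.
by exists (s i).
Qed.

Lemma finite_set_ub A : finite_set A -> exists M, forall n, A n -> (n < M)%N.
Proof.
move=> fA; exists (\max_(i <- fset_set A) i).+1 => n An.
have nA : n \in fset_set A by rewrite in_fset_set// inE.
by rewrite ltnS; exact: (leq_bigmax_seq n nA).
Qed.

Lemma unbounded_infinite A :
  (forall M, exists2 n, (M <= n)%N & A n) -> infinite_set A.
Proof.
move=> h /finite_set_ub[M AM]; have [n + /AM] := h M.
by rewrite leqNgt => /negP.
Qed.

Lemma cvg_le_div (u : R^nat) x (b : nat -> nat) (c : R) :
  (forall K, exists N, forall n, (N <= n)%N -> (K <= b n)%N) ->
  (forall n, (0 < b n)%N -> `|x - u n| * (b n)%:R <= c) ->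
  u @ \oo --> x.
Proof.
move=> bN ub; apply/cvgrPdist_lt => e e0.
have [N hN] := bN (Num.truncn (c / e)).+1.
near=> n; have /hN : (N <= n)%N by near: n; exact: nbhs_infty_ge.
move=> h; have b0 : (0 < b n)%N by exact: leq_trans h.
rewrite -(@ltr_pM2r _ (b n)%:R) ?ltr0n//; apply: le_lt_trans (ub _ b0) _.
rewrite mulrC -ltr_pdivrMr//; apply: lt_le_trans (truncnS_gt _) _.
by rewrite ler_nat.
Unshelve. all: by end_near. Qed.

Lemma finite_cvg0 A : finite_set A -> (avg id A : R^nat) @ \oo --> (0 : R).
Proof.
move=> /finite_set_ub[M AM]; apply: (@cvg_le_div _ _ id M%:R).
  by move=> K; exists K.
move=> n n0; rewrite sub0r normrN ger0_norm ?avg_ge0// /avg divfK ?pnatr_eq0 -?lt0n//.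
rewrite ler_nat /hits; elim: n {n0} => [|n IH]; first by rewrite big_ord0.
have [nM|Mn] := ltnP n M; first exact: leq_trans (hits_le id A n.+1) nM.
by rewrite big_ord_recr/=; case: asboolP => [/AM|_]; rewrite ?addn0// ltnNge Mn.
Qed.

Lemma cofinite_cvg1 A :
  finite_set (~` A) -> (avg id A : R^nat) @ \oo --> (1 : R).
Proof. by move=> /finite_cvg0 /cvg_avgC; rewrite setCK subr0. Qed.

End density_lemmas.

Section blocks.
Implicit Types (s p : nat -> nat).
Local Open Scope nat_scope.

Lemma block_proof n : exists k, n < k.+1 ^ 5.
Proof.
by exists n; have := @leq_pexp2l n.+1 1 5 isT isT; rewrite expn1.
Qed.

(* the [k] with [k ^ 5 <= n < k.+1 ^ 5] *)
Definition block n := ex_minn (block_proof n).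

Lemma blockP n : block n ^ 5 <= n < (block n).+1 ^ 5.
Proof.
rewrite /block; case: ex_minnP => k nk kmin; rewrite nk andbT.
by case: k nk kmin => // k _ kmin; rewrite leqNgt; apply/negP => /kmin; rewrite ltnn.
Qed.

Lemma blockE n k : k ^ 5 <= n < k.+1 ^ 5 -> block n = k.
Proof.
have /andP[h1 h2] := blockP n; move=> /andP[h3 h4]; apply/eqP; rewrite eqn_leq.
have := leq_ltn_trans h1 h4; have := leq_ltn_trans h3 h2.
by rewrite !ltn_exp2r// !ltnS => -> ->.
Qed.

Lemma block_ge K n : K ^ 5 <= n -> K <= block n.
Proof.
have /andP[_ h2] := blockP n => h; have := leq_ltn_trans h h2.
by rewrite ltn_exp2r.
Qed.

Lemma block_lt K n : n < K ^ 5 -> block n < K.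
Proof.
have /andP[h1 _] := blockP n => h; have := leq_ltn_trans h1 h.
by rewrite ltn_exp2r.
Qed.

Lemma block_le n : block n <= n.
Proof.
have /andP[h1 _] := blockP n; apply: leq_trans h1.
by case: (block n) => // k; rewrite -[leqLHS]expn1 leq_pexp2l.
Qed.

Lemma sum_pred1_le n (k : nat) : \sum_(j < n) (j == k :> nat) <= 1.
Proof.
elim: n => [|n IH]; first by rewrite big_ord0.
rewrite big_ord_recr/=; have [->|nk] := eqVneq n k; last by rewrite addn0.
rewrite big1// => i _; by rewrite ltn_eqF.
Qed.

Lemma sum_lt_le s p N n : cancel s p -> cancel p s ->
  \sum_(j < n) (s j < N) <= N.
Proof.
move=> sp ps; have : \sum_(i < N) \sum_(j < n) (j == p i :> nat) <= N.
  rewrite -[leqRHS]card_ord -sum1_card; apply: leq_sum => i _.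
  exact: sum_pred1_le.
apply: leq_trans; rewrite exchange_big/=; apply: leq_sum => j _.
case: ltnP => // h; rewrite (bigD1 (Ordinal h))//= sp eqxx.
exact: leq_addr.
Qed.

Definition sparse s k := (k.+1 ^ 5 + (\sum_(j < k.+1 ^ 5) s j).+1).

Lemma sparse_ge s k : k.+1 ^ 5 <= sparse s k.
Proof. exact: leq_addr. Qed.

Lemma sparse_inv_ge s p k : cancel p s -> k.+1 ^ 5 <= p (sparse s k).
Proof.
move=> ps; rewrite leqNgt; apply/negP => h.
have : sparse s k <= \sum_(j < k.+1 ^ 5) s j.
  by rewrite (bigD1 (Ordinal h))//= ps leq_addr.
by rewrite /sparse addnS ltnNge leq_addl.
Qed.

Lemma hits_sparse s p (f : nat -> nat) n : cancel s p -> cancel p s ->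
  (forall k, k.+1 ^ 5 <= p (f k)) -> hits s (range f) n <= block n.
Proof.
move=> sp ps pf.
have : \sum_(i < block n) \sum_(j < n) (j == p (f i) :> nat) <= block n.
  rewrite -[leqRHS]card_ord -sum1_card; apply: leq_sum => i _.
  exact: sum_pred1_le.
apply: leq_trans; rewrite exchange_big/=; apply: leq_sum => j _.
case: asboolP => // -[k _ fk].
have h : k < block n.
  apply: block_ge; apply: leq_trans (pf k) _.
  by rewrite fk sp ltnW.
by rewrite (bigD1 (Ordinal h))//= fk sp eqxx leq_addr.
Qed.

Fixpoint jump s k : nat :=
  if k is k'.+1 then
    4 * jump s k' + 1 + \sum_(j < 4 * jump s k') s j
  else 1.

Lemma jumpS s k : 4 * jump s k < jump s k.+1.
Proof. by rewrite /= addn1 addSn ltnS leq_addr. Qed.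

Lemma jump_img s k j : j < 4 * jump s k -> s j < jump s k.+1.
Proof.
move=> h; rewrite /= (bigD1 (Ordinal h))//=; lia.
Qed.

Lemma jump_homo s : {homo jump s : i j / i <= j}.
Proof.
by apply: homo_leq => // [? ? ?|k]; [exact: leq_trans|have := jumpS s k; lia].
Qed.

Lemma jump_ge s k : k < jump s k.
Proof. by elim: k => [//|k IH]; have := jumpS s k; lia. Qed.

(* The union of every other interval between fast growing jumps oscillates, both
   in the usual order and in the order given by [s]. *)
Definition jump_set s : set nat :=
  [set m | exists k, ~~ odd k /\ jump s k <= m < jump s k.+1].

Lemma jump_setN s k m : odd k -> jump s k <= m < jump s k.+1 -> ~ jump_set s m.
Proof.
move=> ok /andP[h1 h2] [i [oi /andP[h3 h4]]].
have [ik|ki|ik] := ltngtP i k.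
- by have := jump_homo s ik; lia.
- by have := jump_homo s ki; lia.
- by rewrite ik ok in oi.
Qed.

Lemma hits_jump_even s t p k : cancel t p -> cancel p t ->
  (forall j, j < 4 * jump s k -> t j < jump s k.+1) -> ~~ odd k ->
  hits t (~` jump_set s) (4 * jump s k) <= jump s k.
Proof.
move=> tp pt h ok; apply: leq_trans (sum_lt_le _ (4 * jump s k) tp pt).
apply: leq_sum => j _; case: asboolP => // nj; case: leqP => // lej.
by exfalso; apply: nj; exists k; rewrite ok lej h.
Qed.

Lemma hits_jump_odd s t p k : cancel t p -> cancel p t ->
  (forall j, j < 4 * jump s k -> t j < jump s k.+1) -> odd k ->
  hits t (jump_set s) (4 * jump s k) <= jump s k.
Proof.
move=> tp pt h ok; apply: leq_trans (sum_lt_le _ (4 * jump s k) tp pt).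
apply: leq_sum => j _; case: asboolP => // nj; case: leqP => // lej.
by exfalso; apply: (jump_setN ok _ nj); rewrite lej h.
Qed.

End blocks.

Section sparse_jump.
Context {R : realType}.
Implicit Types (s t p : nat -> nat) (A : set nat).

Lemma cvg_sparse s p (f : nat -> nat) : cancel s p -> cancel p s ->
  (forall k, k.+1 ^ 5 <= p (f k))%N ->
  (avg s (range f) : R^nat) @ \oo --> (0 : R).
Proof.
move=> sp ps pf; apply: (@cvg_le_div _ _ _ block 1).
  by move=> K; exists (K ^ 5)%N => n; exact: block_ge.
move=> n n0; rewrite sub0r normrN ger0_norm ?avg_ge0//.
have n0' : (0 < n)%N by apply: leq_trans (block_le n).
rewrite /avg mulrAC ler_pdivrMr ?ltr0n// mul1r -natrM ler_nat.
apply: (@leq_trans (block n * block n)%N).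
  by rewrite leq_mul2r (hits_sparse _ sp ps pf) orbT.
have /andP[+ _] := blockP n; apply: leq_trans.
by rewrite mulnn leq_pexp2l.
Qed.

Definition frequently_both s A :=
  (forall N, exists2 n, (N <= n)%N & avg s A n <= 4^-1 :> R) /\
  (forall N, exists2 n, (N <= n)%N & 3 / 4 <= avg s A n :> R).

Lemma frequently_both_jump s t p : cancel t p -> cancel p t ->
  (forall k j, j < 4 * jump s k -> t j < jump s k.+1)%N ->
  frequently_both t (jump_set s).
Proof.
move=> tp pt h.
have j0 k : 0 < (jump s k)%:R :> R by rewrite ltr0n (leq_ltn_trans _ (jump_ge s k)).
split => N.
- exists (4 * jump s N.*2.+1)%N; first by have := jump_ge s N.*2.+1; lia.
  have := hits_jump_odd tp pt (h N.*2.+1); rewrite /= odd_double => /(_ isT) hh.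
  rewrite /avg ler_pdivrMr natrM ?mulr_gt0// mulKf// ler_nat//.
- exists (4 * jump s N.*2)%N; first by have := jump_ge s N.*2; lia.
  have := hits_jump_even tp pt (h N.*2); rewrite /= odd_double => /(_ isT) hh.
  rewrite /avg ler_pdivlMr natrM ?mulr_gt0// mulrA divfK//.
  by have := hitsC t (jump_set s) (4 * jump s N.*2); rewrite -natrM ler_nat; lia.
Qed.

End sparse_jump.

Lemma seq_choice (P : seq bool -> bool -> Prop) :
  (forall u, exists b, P u b) ->
  exists a : nat -> bool, forall m, P (mkseq a m) (a m).
Proof.
move=> /choice[F PF]; pose u := fix u m := if m is m'.+1 then rcons (u m') (F (u m')) else [::].
exists (fun m => F (u m)) => m; suff -> : mkseq (fun m => F (u m)) m = u m by [].
by elim: m => // m IH; rewrite mkseqS IH.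
Qed.

Section greedy.
Context {R : realType}.
Context (x : R) (x01 : 0 <= x <= 1).
Implicit Types (b : nat -> nat) (e : nat -> R).

(* For every permutation there is a set that has density x both in the usual
   order and after permutation: its elements are chosen one at a time so that
   the deviations from x on the blocks of both orders, weighted by [w], have
   a bounded sum of squares. *)
Let w (k : nat) : R := (k.+1%:R ^+ 6)^-1.

Let w_ge0 k : 0 <= w k. Proof. by rewrite invr_ge0 exprn_ge0. Qed.

Definition disc b e m k : R := \sum_(i < m | b i == k) e i.

Lemma discS b e m k : disc b e m.+1 k = disc b e m k + (k == b m)%:R * e m.
Proof.
rewrite /disc !(big_mkcond (fun i => _ == _)) big_ord_recr/= eq_sym.
by case: eqP; rewrite ?mul1r ?mul0r.
Qed.

Lemma eq_disc b e e' m k : (forall i, (i < m)%N -> e i = e' i) ->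
  disc b e m k = disc b e' m k.
Proof. by move=> ee; apply: eq_bigr => i _; exact: ee. Qed.

Definition pot K b e m : R := \sum_(k < K) w k * disc b e m k ^+ 2.

Lemma potS K b e m : (b m < K)%N -> pot K b e m.+1 =
  pot K b e m + w (b m) * (2 * e m * disc b e m (b m) + e m ^+ 2).
Proof.
move=> h; rewrite /pot.
rewrite -[X in _ + X](@big_pred1 R 0 +%R 'I_K (Ordinal h) (pred1 (Ordinal h))
  (fun k => w k * (2 * e m * disc b e m k + e m ^+ 2)))//.
rewrite big_mkcond/= -big_split/=; apply: eq_bigr => k _.
rewrite discS -val_eqE/=; case: eqP => _; first by rewrite mul1r; ring.
by rewrite mul0r !addr0.
Qed.

Definition dev (a : nat -> bool) i : R := (a i)%:R - x.

Lemma dev_sqr a i : dev a i ^+ 2 <= 1.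
Proof.
by rewrite /dev; have /andP[x0 x1] := x01; case: (a i) => /=; nra.
Qed.

Lemma exists_bits b1 b2 : exists a : nat -> bool, forall m,
  dev a m * (w (b1 m) * disc b1 (dev a) m (b1 m)
    + w (b2 m) * disc b2 (dev a) m (b2 m)) <= 0.
Proof.
pose G (u : seq bool) : R := let m := size u in
  w (b1 m) * disc b1 (dev (nth false u)) m (b1 m)
    + w (b2 m) * disc b2 (dev (nth false u)) m (b2 m).
have [u|a Pa] := @seq_choice (fun u (c : bool) => (c%:R - x) * G u <= 0).
  have /andP[x0 x1] := x01.
  by have [g|g] := leP 0 (G u); [exists false|exists true] => /=; nra.
exists a => m; have := Pa m; rewrite /G size_mkseq.
have E b k : disc b (dev (nth false (mkseq a m))) m k = disc b (dev a) m k.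
  by apply: eq_disc => i im; rewrite /dev nth_mkseq.
by rewrite !E.
Qed.

Lemma pot_bound b1 b2 a K m :
  (forall m, dev a m * (w (b1 m) * disc b1 (dev a) m (b1 m)
    + w (b2 m) * disc b2 (dev a) m (b2 m)) <= 0) ->
  (forall i, (i < m)%N -> (b1 i < K)%N /\ (b2 i < K)%N) ->
  pot K b1 (dev a) m + pot K b2 (dev a) m
    <= \sum_(i < m) w (b1 i) + \sum_(i < m) w (b2 i).
Proof.
move=> ha; elim: m => [|m IH] hK.
  rewrite !big_ord0 addr0 /pot big1 ?big1 ?addr0// => k _;
  by rewrite /disc big_ord0 expr0n mulr0.
have [h1 h2] := hK m (ltnSn m).
rewrite !potS// !big_ord_recr/=.
have {}IH := IH (fun i im => hK i (ltnW im)).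
have := ha m; have := dev_sqr a m; have := w_ge0 (b1 m); have := w_ge0 (b2 m).
set e := dev a m; set d1 := disc _ _ _ _; set d2 := disc _ _ _ _.
set w1 := w _; set w2 := w _; move=> w20 w10 e1 h.
have t1 : w1 * e ^+ 2 <= w1 by rewrite ler_piMr.
have t2 : w2 * e ^+ 2 <= w2 by rewrite ler_piMr.
move: IH; lra.
Qed.

Lemma sum_block_w_pow K : (0 < K)%N ->
  \sum_(0 <= i < K ^ 5) w (block i) <= 5 * (2 - K%:R^-1).
Proof.
elim: K => // K IH _; have [->|K0] := posnP K.
  rewrite exp1n big_nat1 (@blockE 0 0)// /w expr1n invr1; lra.
rewrite (@big_cat_nat _ _ _ (K ^ 5)%N)//=; last by rewrite leq_exp2r.
have {}IH := IH K0.
have -> : \sum_(K ^ 5 <= i < K.+1 ^ 5) w (block i)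
    = \sum_(K ^ 5 <= i < K.+1 ^ 5) w K.
  by apply: eq_big_nat => i hi; rewrite (blockE hi).
rewrite big_const_nat iter_addr_0.
have k0 : 0 < K%:R :> R by rewrite ltr0n.
have hN : (K.+1 ^ 5 - K ^ 5 <= 5 * K.+1 ^ 4)%N.
  by rewrite !expnS expn0; nia.
have : w K *+ (K.+1 ^ 5 - K ^ 5) <= 5 * (K%:R^-1 - K.+1%:R^-1).
  rewrite -[leLHS]mulr_natr; apply: (@le_trans _ _ (w K * (5 * K.+1 ^ 4)%N%:R)).
    by rewrite ler_wpM2l// ler_nat.
  rewrite natrM natrX mulrCA ler_pM2l// /w -natr1.
  set k := K%:R; have k1 : 0 < k + 1 by rewrite ltr_wpDl// ltW.
  rewrite -(ler_pM2l (exprn_gt0 6 k1)) mulrA divff ?mul1r ?lt0r_neq0 ?exprn_gt0//.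
  rewrite (_ : _ * (_ - _) = (k + 1) ^+ 4 + (k + 1) ^+ 4 / k); last first.
    by field; rewrite !lt0r_neq0.
  by rewrite lerDl divr_ge0 ?exprn_ge0 ?ltW.
by move=> h; apply: le_trans (lerD IH h) _; rewrite -mulrDr addrA subrK.
Qed.

Lemma sum_block_w (u : seq nat) : uniq u -> \sum_(i <- u) w (block i) <= 10.
Proof.
move=> uu; have [M M0 uM] : exists2 M, (0 < M)%N & {subset u <= iota 0 (M ^ 5)}.
  exists (\max_(i <- u) i).+1 => // i iu; rewrite mem_iota add0n.
  apply: (@leq_trans (\max_(i <- u) i).+1).
    by rewrite ltnS; exact: (leq_bigmax_seq i iu).
  by rewrite -[leqLHS]expn1 leq_pexp2l.
apply: (@le_trans _ _ (\sum_(0 <= i < M ^ 5) w (block i))).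
  rewrite /index_iota subn0 [leRHS](bigID (mem u))/= -[leLHS]addr0.
  apply: lerD; last exact: sumr_ge0.
  rewrite -[leRHS]big_filter le_eqVlt; apply/orP; left; apply/eqP/perm_big.
  apply: uniq_perm => //; first by rewrite filter_uniq// iota_uniq.
  move=> i; rewrite mem_filter/=; case: (boolP (i \in u)) => //= iu.
  by rewrite uM.
apply: le_trans (sum_block_w_pow _) _ => //.
have : 0 <= M%:R^-1 :> R by rewrite invr_ge0.
lra.
Qed.

Lemma disc_bound s p : cancel s p -> cancel p s -> exists a : nat -> bool,
  forall m k, `|disc block (dev a) m k| <= 5 * k.+1%:R ^+ 3 /\
              `|disc (block \o p) (dev a) m k| <= 5 * k.+1%:R ^+ 3.
Proof.
move=> sp ps; have [a ha] := exists_bits block (block \o p).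
exists a => m k; pose K := (k + \sum_(i < m) (block i + block (p i))).+1.
have hK i : (i < m)%N -> (block i < K)%N /\ (block (p i) < K)%N.
  by move=> im; rewrite /K (bigD1 (Ordinal im))//=; lia.
have kK : (k < K)%N by rewrite ltnS leq_addr.
have := pot_bound ha hK.
have s1 : \sum_(i < m) w (block i) <= 10.
  rewrite -(big_mkord xpredT (fun i => w (block i))); apply: sum_block_w.
  exact: iota_uniq.
have s2 : \sum_(i < m) w (block (p i)) <= 10.
  rewrite -(big_mkord xpredT (fun i => w (block (p i)))).
  rewrite -(big_map p xpredT (fun i => w (block i))); apply: sum_block_w.
  by rewrite map_inj_uniq ?iota_uniq//; exact: can_inj ps.
have pot_ge0 b : 0 <= pot K b (dev a) m.
  by apply: sumr_ge0 => i _; rewrite mulr_ge0 ?sqr_ge0.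
have pot_ge b : w k * disc b (dev a) m k ^+ 2 <= pot K b (dev a) m.
  rewrite /pot (bigD1 (Ordinal kK))//= lerDl.
  by apply: sumr_ge0 => i _; rewrite mulr_ge0 ?sqr_ge0.
have fin b : pot K b (dev a) m <= 20 -> `|disc b (dev a) m k| <= 5 * k.+1%:R ^+ 3.
  move=> /(le_trans (pot_ge b)).
  rewrite /w mulrC ler_pdivrMr ?exprn_gt0// => h.
  rewrite -(@ler_pXn2r _ 2)// ?nnegrE ?mulr_ge0 ?exprn_ge0//.
  rewrite real_normK ?num_real// exprMn -exprM; apply: le_trans h _.
  by rewrite ler_wpM2r ?exprn_ge0//; lra.
move=> h; split; apply: fin.
- have := pot_ge0 (block \o p); rewrite /= in h *; move: h s1 s2; rewrite /=; lra.
- have := pot_ge0 block; rewrite /= in h *; move: h s1 s2; rewrite /=; lra.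
Qed.

Lemma cvg_avg_disc t q (a : nat -> bool) : cancel t q -> cancel q t ->
  (forall m k, `|disc (block \o q) (dev a) m k| <= 5 * k.+1%:R ^+ 3) ->
  (avg t [set i | a i] : R^nat) @ \oo --> x.
Proof.
move=> tq qt ha; apply: (@cvg_le_div _ _ _ block 160).
  by move=> K; exists (K ^ 5)%N => n; exact: block_ge.
move=> n n0; have n0' : (0 < n)%N by apply: leq_trans (block_le n).
set k := block n in n0 *; have /andP[kn nk] := blockP n; rewrite -/k in kn nk.
have win i : \sum_(i ^ 5 <= j < i.+1 ^ 5) dev a (t j)
    = disc (block \o q) (dev a) (\max_(j < i.+1 ^ 5) t j).+1 i.
  set M := (\max_(j < _) _).+1.
  rewrite /disc -(big_mkord (fun j => block (q j) == i) (dev a)).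
  rewrite -(big_map t xpredT (dev a)) -[RHS]big_filter.
  apply: perm_big; apply: uniq_perm.
  - by rewrite map_inj_uniq ?iota_uniq//; exact: can_inj tq.
  - by rewrite filter_uniq// iota_uniq.
  move=> l; rewrite mem_filter mem_index_iota leq0n/=; apply/mapP/andP.
    move=> [j]; rewrite mem_index_iota => /[dup] /blockE bj /andP[_ hj] ->.
    rewrite tq bj eqxx; split => //.
    by rewrite ltnS; exact: (@leq_bigmax _ (fun j : 'I_(i.+1 ^ 5) => t j) (Ordinal hj)).
  move=> [/eqP bq _]; exists (q l); last by rewrite qt.
  by rewrite mem_index_iota -bq blockP.
have pre i : `|\sum_(0 <= j < i ^ 5) dev a (t j)| <= 5 * i%:R ^+ 4.
  elim: i => [|i IH]; first by rewrite big_geq// normr0 mulr_ge0// exprn_ge0.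
  rewrite (@big_cat_nat _ _ _ (i ^ 5)%N)//=; last by rewrite leq_exp2r.
  apply: le_trans (ler_normD _ _) _; apply: le_trans (lerD IH _) _.
    by rewrite win; exact: ha.
  rewrite -!natrX -!natrM -natrD ler_nat !expnS !expn0; nia.
have tot : `|\sum_(0 <= j < n) dev a (t j)| <= 160 * k%:R ^+ 4.
  rewrite (@big_cat_nat _ _ _ (k ^ 5)%N)//=.
  apply: le_trans (ler_normD _ _) _; apply: le_trans (lerD (pre k) _) _.
    apply: (@le_trans _ _ (\sum_(k ^ 5 <= j < n) 1)).
      apply: le_trans (ler_norm_sum _ _ _) _; apply: ler_sum => j _.
      rewrite -(@ler_pXn2r _ 2)// ?nnegrE// real_normK ?num_real// expr1n.
      exact: dev_sqr.
    rewrite sumr_const_nat; exact: lexx.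
  rewrite -!natrX -!natrM -natrD ler_nat.
  have : (n - k ^ 5 <= k.+1 ^ 5 - k ^ 5)%N by rewrite leq_sub2r// ltnW.
  have : (k.+1 ^ 5 - k ^ 5 <= 5 * k.+1 ^ 4)%N by rewrite !expnS expn0; nia.
  have : (k.+1 ^ 4 <= (2 * k) ^ 4)%N by rewrite leq_exp2r//; lia.
  rewrite expnMn; lia.
have -> : x - avg t [set i | a i] n = - (\sum_(0 <= j < n) dev a (t j)) / n%:R.
  rewrite big_mkord /dev sumrB sumr_const card_ord.
  rewrite /avg /hits natr_sum opprB mulrBl -[x *+ n]mulr_natr mulfK ?pnatr_eq0 -?lt0n//.
  by congr (_ - _ / _); apply: eq_bigr => j _; rewrite asboolb.
rewrite normrM normrN normfV normr_nat mulrAC ler_pdivrMr ?ltr0n//.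
apply: (@le_trans _ _ (160 * k%:R ^+ 4 * k%:R)); first by rewrite ler_wpM2r.
by rewrite -mulrA -exprSr ler_wpM2l// -natrX ler_nat.
Qed.

End greedy.

Section axioms.
Context {R : realType}.
Implicit Types (s p : nat -> nat) (A B : set nat) (v : density_value R).

Lemma infinite_density A : density A <> Dens 0 :> density_value R -> infinite_set A.
Proof.
apply: contra_not => /(@finite_cvg0 R) h; apply: density_cvg.
by rewrite rel_freqE.
Qed.

Lemma coinfinite_density A :
  density A <> Dens 1 :> density_value R -> infinite_set (~` A).
Proof.
apply: contra_not => /(@cofinite_cvg1 R) h; apply: density_cvg.
by rewrite rel_freqE.
Qed.

Lemma exists_densities s p v : cancel s p -> cancel p s -> all_densities v ->
  exists A, [/\ infinite_set A, infinite_set (~` A),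
    density A = v & density (p @` A) = v].
Proof.
move=> sp ps.
have D A r : (avg id A : R^nat) @ \oo --> r -> density A = Dens r.
  by move=> h; apply: density_cvg; rewrite rel_freqE.
have Dp A r : (avg s A : R^nat) @ \oo --> r -> density (p @` A) = Dens r.
  by move=> h; apply: density_cvg; rewrite (rel_freq_image _ sp ps).
have inf_sparse : infinite_set (range (sparse s)).
  apply: unbounded_infinite => M; exists (sparse s M); last by exists M.
  apply: leq_trans (sparse_ge s M); apply: (leq_trans (leqnSn M)).
  have := @leq_pexp2l M.+1 1 5 isT isT; by rewrite expn1.
have sparse0 := @cvg_sparse R id id (sparse s) (fun=> erefl) (fun=> erefl)
  (sparse_ge s).
have sparse0' := @cvg_sparse R s p (sparse s) sp ps
  (fun k => sparse_inv_ge k ps).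
case=> [[r]|-> {v}].
  rewrite /= in_itv/= => r01 <- {v}.
  have [->|r0] := eqVneq r 0.
    exists (range (sparse s)); split=> //; [|exact: D|exact: Dp].
    apply: coinfinite_density; rewrite (D _ _ sparse0) => -[] /esym/eqP.
    by rewrite oner_eq0.
  have [->|r1] := eqVneq r 1.
    exists (~` range (sparse s)); rewrite setCK; split=> //.
    - apply: infinite_density; have := D _ _ (cvg_avgC sparse0).
      by rewrite subr0 => -> -[] /eqP; rewrite oner_eq0.
    - by have := D _ _ (cvg_avgC sparse0); rewrite subr0.
    - by have := Dp _ _ (cvg_avgC sparse0'); rewrite subr0.
  have [a ha] := disc_bound r01 sp ps.
  have Da : density [set i | a i] = Dens r.
    apply/D/(cvg_avg_disc r01 (fun=> erefl) (fun=> erefl)) => m k.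
    exact: (ha m k).1.
  have Dpa : density (p @` [set i | a i]) = Dens r.
    by apply/Dp/(cvg_avg_disc r01 sp ps) => m k; exact: (ha m k).2.
  exists [set i | a i]; split=> //.
    by apply: infinite_density; rewrite Da => -[]; exact/eqP.
  by apply: coinfinite_density; rewrite Da => -[]; exact/eqP.
have Dj : density (jump_set s) = Osc :> density_value R.
  have [h1 h2] : @frequently_both R id (jump_set s).
    apply: (@frequently_both_jump _ s id id) => // k j jk.
    exact: leq_trans jk (ltnW (jumpS s k)).
  by apply: density_osc => N; rewrite rel_freqE; [exact: h1|exact: h2].
have Dpj : density (p @` jump_set s) = Osc :> density_value R.
  have [h1 h2] : @frequently_both R s (jump_set s).
    apply: (@frequently_both_jump _ s s p) => // k j; exact: jump_img.
  by apply: density_osc => N; rewrite (rel_freq_image _ sp ps); [exact: h1|exact: h2].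
exists (jump_set s); split=> //.
  by apply: infinite_density; rewrite Dj.
by apply: coinfinite_density; rewrite Dj.
Qed.

Lemma infinite_set_bij A B : infinite_set A -> infinite_set B ->
  exists f : nat -> nat, set_bij A B f.
Proof.
move=> iA iB; apply/card_set_bijP.
apply: card_eq_trans (eq_card_nat (countableP A) iA) _.
by rewrite card_eq_sym; exact: eq_card_nat (countableP B) iB.
Qed.

Lemma exists_perm A B : infinite_set A -> infinite_set (~` A) ->
  infinite_set B -> infinite_set (~` B) -> exists p : Sym, sval p @` A = B.
Proof.
move=> iA icA iB icB.
have [f [fAB finj fsurj]] := infinite_set_bij iA iB.
have [g [gAB ginj gsurj]] := infinite_set_bij icA icB.
pose h n := if n \in A then f n else g n.
have hA n : A n -> h n = f n by move=> An; rewrite /h mem_set.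
have hN n : ~ A n -> h n = g n by move=> An; rewrite /h memNset.
have hB n : A n -> B (h n) by move=> An; rewrite hA//; exact: fAB.
have hNB n : ~ A n -> ~ B (h n) by move=> An; rewrite hN//; exact: gAB.
have hinj : injective h.
  move=> m n; have [Am|Am] := pselect (A m); have [An|An] := pselect (A n).
  - by rewrite !hA//; apply: finj; exact: mem_set.
  - by move=> e; exfalso; apply: (hNB _ An); rewrite -e; exact: hB.
  - by move=> e; exfalso; apply: (hNB _ Am); rewrite e; exact: hB.
  - by rewrite !hN//; apply: ginj; exact: mem_set.
have hsurj n : exists m, h m = n.
  have [Bn|Bn] := pselect (B n).
    by have [m Am <-] := fsurj _ Bn; exists m; rewrite hA.
  by have [m Am <-] := gsurj _ Bn; exists m; rewrite hN.
have hbij : bijective h.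
  have [k hk] := choice hsurj.
  by exists k => // n; apply: hinj.
exists (exist _ h hbij) => /=; apply/seteqP; split => [_ [n An <-]|n Bn].
  exact: hB.
by have [m Am <-] := fsurj _ Bn; exists m => //; rewrite hA.
Qed.

Context (X Y : set (density_value R)).

Lemma density_rel_total : Y `<=` all_densities ->
  (forall x, X x -> exists2 y, Y y & y <> x) ->
  forall A : density_set X, exists p : Sym, density_rel Y A p.
Proof.
move=> Yall XY [A [iA icA XA]]; have [y Yy yA] := XY _ XA.
have [B [iB icB Dy _]] :=
  exists_densities (fun=> erefl : id _ = _) (fun=> erefl) (Yall _ Yy).
have [p pAB] := exists_perm iA icA iB icB.
by exists p; rewrite /density_rel /= pAB Dy.
Qed.

Lemma density_rel_unbounded : X `<=` all_densities -> X !=set0 ->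
  forall p : Sym, exists A : density_set X, ~ density_rel Y A p.
Proof.
move=> Xall [x Xx] [p [s ps sp]].
have [A [iA icA DA DpA]] := exists_densities sp ps (Xall _ Xx).
have XA : X (density A) by rewrite DA.
exists (exist _ A (And3 iA icA XA)) => -[_] /=.
by rewrite DA DpA.
Qed.

End axioms.

Lemma ur_total (A : infinite_subset) :
  exists B : infinite_subset, ur_rel A B.
Proof. by exists A; left; rewrite setDv. Qed.

Lemma ur_unbounded (B : infinite_subset) :
  exists A : infinite_subset, ~ ur_rel A B.
Proof.
case: B => B iB; have nfin : infinite_set [set: nat] by exact: infinite_nat.
have iE : infinite_set [set n | ~~ odd n].
  by apply: unbounded_infinite => M; exists M.*2; rewrite /= ?odd_double; lia.
have iO : infinite_set (~` [set n | ~~ odd n]).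
  by apply: unbounded_infinite => M; exists M.*2.+1; rewrite /= ?odd_double//; lia.
have [f [/(_ _ I) fB finj _]] := infinite_set_bij nfin iB.
have iimg C : infinite_set C -> infinite_set (f @` C).
  move=> iC fC; apply: iC; apply: sub_finite_set (finite_preimage _ fC).
    by move=> n Cn; exists n.
  by move=> m n _ _; apply: finj; exact: mem_set.
pose A := f @` [set n | ~~ odd n].
exists (exist _ A (iimg _ iE)) => -[] /=.
  apply: (@sub_infinite_set _ (f @` (~` [set n | ~~ odd n]))); last exact: iimg.
  move=> _ [n On <-]; split; first exact: fB.
  move=> [m Em mn]; apply: On; rewrite -(finj m n)//; exact: mem_set.
apply: (@sub_infinite_set _ A); last exact: iimg.
by move=> _ [n En <-]; split; [exact: fB|exists n].
Qed.

Definition density_system (R : realType) (X Y : set (density_value R))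
    (Xall : X `<=` all_densities) (Yall : Y `<=` all_densities)
    (X0 : X !=set0) (XY : forall x, X x -> exists2 y, Y y & y <> x) :
    relational_system :=
  RelationalSystem (density_rel_total Yall XY)
    (density_rel_unbounded Y Xall X0).

Definition ur_system : relational_system :=
  RelationalSystem ur_total ur_unbounded.

(* Main.v *)
Require Import Defs.
From mathcomp Require Import all_boot all_order all_algebra finmap.
From mathcomp Require Import all_classical all_reals all_analysis.
From mathcomp Require Import zify lra.

Set Implicit Arguments.
Unset Strict Implicit.
Unset Printing Implicit Defensive.

Import Order.TTheory GRing.Theory Num.Theory.
Import numFieldNormedType.Exports.

Local Open Scope classical_set_scope.
Local Open Scope ring_scope.

(** The first map of the reduction sends [A] to itself. The second sends an
infinite set [B] to a permutation that makes an asymptotically negligible part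
of [B] as important as possible: choose an infinite [C] inside [B] of density
[0] ([null_subset]), a set [E] of density [r], and let the permutation carry [C]
onto [E] and the complement of [C] onto that of [E], both in increasing order
([transfer]).

If [B] does not split [A], then [A] contains almost all of [C] or almost nothing
of it, so the image of [A] has relative density [1] or [0] inside [E]. Outside
[E] its relative density is that of [A] outside [C], which is the density [x] of
[A] because [C] is negligible ([cvg_avg_enumC]). Weighting the two parts by [r]
and [1 - r] gives the image the density [r + x * (1 - r)] or [x * (1 - r)]
([exists_shift]). Both values differ from [x], since [r > 0] and [x] is neither
[0] nor [1].

When [0] and [1] belong to [Y] one takes [r = 1]: the part outside [E] then has
weight [0], so the argument covers sets [A] without density as well.

All computations rest on one identity, [avg_transfer]. Since [avg (enum C) A] is
the sequence of relative frequencies of [A] inside [C], the identity splits the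
frequencies of the image of [A] over [E] and its complement. Applied to the
identity permutation, it also shows that a negligible set can be removed without
changing densities. *)

(** * Increasing enumerations of sets of naturals *)

Section enumeration.
Implicit Types (C E A : set nat).
Local Open Scope nat_scope.

Lemma hitsS s A n : hits s A n.+1 = hits s A n + `[< A (s n) >].
Proof. by rewrite /hits big_ord_recr. Qed.

(** With [s := id], [hits id C n] is the rank of [n] with respect to [C], the
number of elements of [C] below [n]. *)
Lemma rank_homo C m n : m <= n -> hits id C m <= hits id C n.
Proof.
move=> /subnK <-; elim: (n - m) => [//|k IH].
by rewrite addSn hitsS (leq_trans IH)// leq_addr.
Qed.

Lemma rank_lt C m n : C m -> m < n -> hits id C m < hits id C n.
Proof.
move=> Cm /(@rank_homo C); apply: leq_trans.
by rewrite hitsS asboolT// addn1.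
Qed.

Lemma rank_inj C m n : C m -> C n -> hits id C m = hits id C n -> m = n.
Proof.
move=> Cm Cn e; have [h|h|//] := ltngtP m n.
  by have := rank_lt Cm h; rewrite e ltnn.
by have := rank_lt Cn h; rewrite e ltnn.
Qed.

Lemma infinite_set_above C N : infinite_set C -> exists2 n, N <= n & C n.
Proof.
move=> iC; apply: contrapT => h; apply: iC.
apply: sub_finite_set (finite_II N) => n Cn /=.
by rewrite ltnNge; apply/negP => Nn; apply: h; exists n.
Qed.

Lemma rank_unbounded C m : infinite_set C -> exists n, m <= hits id C n.
Proof.
move=> iC; elim: m => [|m [N mN]]; first by exists 0.
have [n Nn Cn] := infinite_set_above N iC; exists n.+1.
by rewrite (leq_ltn_trans (leq_trans mN (rank_homo C Nn)))// rank_lt.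
Qed.

(** The increasing enumeration of an infinite [C], as the inverse of the rank
function on [C]. *)
Definition enum C m : nat := xget 0 [set n | C n /\ hits id C n = m].

Lemma enumP C m : infinite_set C -> C (enum C m) /\ hits id C (enum C m) = m.
Proof.
move=> iC; apply: (xgetPex 0 (P := [set n | C n /\ hits id C n = m])).
have ex : exists n, m < hits id C n.+1.
  have [n mn] := rank_unbounded m.+1 iC; exists n.
  exact: leq_trans mn (rank_homo C (leqnSn n)).
(* The rank grows by at most one at each step, so at the first [n] where it
   exceeds [m] it equals [m], and [n] belongs to [C]. *)
have [n mn nmin] := ex_minnP ex; exists n.
have nm : hits id C n <= m.
  case: n {mn} nmin => [_|n nmin]; first by rewrite /hits big_ord0.
  by rewrite leqNgt; apply/negP => /nmin; rewrite ltnn.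
move: mn; rewrite hitsS; case: asboolP => [Cn|_] mn; last lia.
by split => //; lia.
Qed.

Lemma enumK C n : infinite_set C -> C n -> enum C (hits id C n) = n.
Proof.
move=> iC Cn; have [Ce e] := enumP (hits id C n) iC.
exact: rank_inj Ce Cn e.
Qed.

Lemma enum_inj C : infinite_set C -> injective (enum C).
Proof.
move=> iC i j e; have [_ <-] := enumP i iC; have [_ <-] := enumP j iC.
by rewrite e.
Qed.

Lemma enum_ge C m : infinite_set C -> m <= enum C m.
Proof. by move=> iC; have [_ {1}<-] := enumP m iC; exact: hits_le. Qed.

Lemma cvg_rank C : infinite_set C -> hits id C n @[n --> \oo] --> \oo.
Proof.
move=> iC; apply/cvgnyPge => m; have [N mN] := rank_unbounded m iC.
near=> n; apply: leq_trans mN (rank_homo _ _).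
by near: n; exact: nbhs_infty_ge.
Unshelve. all: by end_near. Qed.

Lemma cvg_enum C : infinite_set C -> enum C n @[n --> \oo] --> \oo.
Proof.
move=> iC; apply/cvgnyPge => m; near=> n; apply: leq_trans (enum_ge n iC).
by near: n; exact: nbhs_infty_ge.
Unshelve. all: by end_near. Qed.

(** For infinite-coinfinite [E] and [C], the bijection of the naturals that is
increasing from [E] onto [C] and from the complement onto the complement. *)
Definition transfer E C n : nat :=
  if `[< E n >] then enum C (hits id E n) else enum (~` C) (hits id (~` E) n).

Lemma transferK E C : infinite_set E -> infinite_set (~` E) ->
  infinite_set C -> infinite_set (~` C) -> cancel (transfer E C) (transfer C E).
Proof.
move=> iE iE' iC iC' n; rewrite {2}/transfer; case: asboolP => En.
  have [Ce e] := enumP (hits id E n) iC.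
  by rewrite /transfer asboolT// e enumK.
have [Ce e] := enumP (hits id (~` E) n) iC'.
by rewrite /transfer asboolF// e enumK.
Qed.

Lemma transfer_id E : infinite_set E -> infinite_set (~` E) ->
  transfer E E = id.
Proof.
move=> iE iE'; apply/funext => n; rewrite /transfer.
by case: asboolP => En; rewrite enumK.
Qed.

Lemma hits_transfer E C A n : hits (transfer E C) A n =
  hits (enum C) A (hits id E n) + hits (enum (~` C)) A (hits id (~` E) n).
Proof.
elim: n => [|n IH]; first by rewrite /hits !big_ord0.
rewrite !hitsS IH /transfer /= asbool_neg.
by case: (asboolP (E n)) => En; rewrite !addn0 !addn1 hitsS ?addnA // addnAC.
Qed.

End enumeration.

(** * Relative densities *)

Section relative_density.
Context {R : realType}.
Implicit Types (A B C E : set nat).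

(** The relative frequency of a set is the weighted mean of its relative
frequencies inside [E] and outside [E]. Below [n], the map [transfer E C] runs
through initial segments of the enumerations of [C] and of its complement,
whose lengths are the numbers of elements of [E] and of its complement
below [n]. *)
Lemma avg_transfer E C A n : avg (transfer E C) A n =
  avg (enum C) A (hits id E n) * avg id E n +
  avg (enum (~` C)) A (hits id (~` E) n) * avg id (~` E) n :> R.
Proof.
(* For [m = 0] both sides vanish, by the convention [0 / 0 = 0]. *)
have scale s m : (hits s A m)%:R / n%:R = avg s A m * (m%:R / n%:R) :> R.
  rewrite /avg; case: m => [|m]; last by rewrite mulrA divfK.
  by rewrite /hits big_ord0 !mul0r.
by rewrite -[avg id E n]/(_ / _) -[avg id (~` E) n]/(_ / _) -!scale -mulrDl
  -natrD -hits_transfer.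
Qed.

Lemma cvg_density A (x : R) :
  density A = Dens x -> (avg id A : R^nat) @ \oo --> x.
Proof.
rewrite -rel_freqE /density; case: eqP => // e -[] ex.
have ub : has_ubound (range (rel_freq A : R^nat)).
  by exists 1 => _ [n _ <-]; rewrite rel_freqE avg_le1.
have lb : has_lbound (range (rel_freq A : R^nat)).
  by exists 0 => _ [n _ <-]; rewrite rel_freqE avg_ge0.
have hs := cvg_sups_inf ub lb; have hi := cvg_infs_sup ub lb.
have hl : lower_density A = sup (range (infs (rel_freq A : R^nat))).
  by apply/cvg_lim.
have hu : upper_density A = inf (range (sups (rel_freq A : R^nat))).
  by apply/cvg_lim.
rewrite -hl ex in hi; rewrite -hu -e ex in hs.
apply: squeeze_cvgr hi hs; near=> n; apply/andP; split.
  by apply: ge_inf; [exact: has_lbound_sdrop|exists n => //=].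
by apply: ub_le_sup; [exact: has_ubound_sdrop|exists n => //=].
Unshelve. all: by end_near. Qed.

Lemma cvg_avg_enum1 B C A : infinite_set C -> C `<=` B ->
  finite_set (B `\` A) -> (avg (enum C) A : R^nat) @ \oo --> (1 : R).
Proof.
move=> iC CB fBA; apply: (@cofinite_cvg1 R (enum C @^-1` A)).
have := finite_preimage (in2W (enum_inj iC)) fBA.
apply: sub_finite_set => m /= Am; split=> //; apply: CB.
exact: (enumP m iC).1.
Qed.

Lemma cvg_avg_enum0 B C A : infinite_set C -> C `<=` B ->
  finite_set (B `&` A) -> (avg (enum C) A : R^nat) @ \oo --> (0 : R).
Proof.
move=> iC CB fBA; apply: (@finite_cvg0 R (enum C @^-1` A)).
have := finite_preimage (in2W (enum_inj iC)) fBA.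
apply: sub_finite_set => m /= Am; split=> //; apply: CB.
exact: (enumP m iC).1.
Qed.

(** Removing a set of density [0] does not change densities. With [E := C],
[avg_transfer] decomposes the plain frequencies of [A]; at the [m]-th element of
the complement of [C] it can be solved for the relative frequency of [A] among
the first [m] elements of that complement. *)
Lemma cvg_avg_enumC C A (x : R) : infinite_set C -> infinite_set (~` C) ->
  (avg id C : R^nat) @ \oo --> (0 : R) -> (avg id A : R^nat) @ \oo --> x ->
  (avg (enum (~` C)) A : R^nat) @ \oo --> x.
Proof.
move=> iC iC' C0 Ax; have hn := cvg_enum iC'.
have C0' := cvg_comp _ _ hn C0; have Ax' := cvg_comp _ _ hn Ax.
have C1 := cvg_comp _ _ hn (cvg_avgC C0); rewrite subr0 in C1.
have prod0 : (avg (enum C) A (hits id C (enum (~` C) m)) *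
    avg id C (enum (~` C) m) : R) @[m --> \oo] --> (0 : R).
  apply: squeeze_cvgr (cvg_cst 0) C0'; near=> m => /=.
  by rewrite mulr_ge0 ?avg_ge0//= ler_piMl ?avg_ge0 ?avg_le1.
have : ((avg id A (enum (~` C) m) - avg (enum C) A (hits id C (enum (~` C) m)) *
    avg id C (enum (~` C) m)) / avg id (~` C) (enum (~` C) m) : R)
    @[m --> \oo] --> (x - 0) / 1.
  apply: cvgM; first exact: cvgB.
  by apply: cvgV => //; exact: oner_neq0.
rewrite subr0 divr1; apply: cvg_trans; apply: near_eq_cvg; near=> m.
have nz : avg id (~` C) (enum (~` C) m) != 0 :> R.
  by near: m; apply: (@cvgr_neq0 R R^o _ _ _ _ 1 C1); exact: oner_neq0.
have [_ hm] := enumP m iC'.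
have := avg_transfer C C A (enum (~` C) m).
by rewrite transfer_id// hm => ->; rewrite addrAC subrr add0r mulfK.
Unshelve. all: by end_near. Qed.

(** Choosing the [k]-th element of the subset beyond the fifth power of [k.+1]
makes it sparse enough for [cvg_sparse]. *)
Lemma null_subset B : infinite_set B -> exists C,
  [/\ C `<=` B, infinite_set C, infinite_set (~` C) &
      (avg id C : R^nat) @ \oo --> (0 : R)].
Proof.
move=> iB.
have g k : {n | (k.+1 ^ 5 <= n)%N & B n}.
  by apply: cid2; exact: infinite_set_above.
have g_ge k : (k.+1 ^ 5 <= s2val (g k))%N by exact: (s2valP (g k)).
have C0 := @cvg_sparse R id id _ (fun=> erefl) (fun=> erefl) g_ge.
exists (range (fun k => s2val (g k))); split=> //.
- by move=> _ [k _ <-]; exact: (s2valP' (g k)).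
- apply: unbounded_infinite => M; exists (s2val (g M)); last by exists M.
  apply: leq_trans (g_ge M); apply: (leq_trans (leqnSn M)).
  by have := @leq_pexp2l M.+1 1 5 isT isT; rewrite expn1.
- apply: (@coinfinite_density R); rewrite (@density_cvg R _ 0) ?rel_freqE//.
  by move=> [] /esym/eqP; rewrite oner_eq0.
Qed.

(** When [r = 1], the complement of [E] has density [0] and contributes nothing in
the limit even if [A] has no density, as the factor [1 - r] of [x] reflects. *)
Lemma density_transfer C E A (r u x : R) :
  infinite_set C -> infinite_set (~` C) -> infinite_set E -> infinite_set (~` E) ->
  (avg id C : R^nat) @ \oo --> (0 : R) -> density E = Dens r ->
  (avg (enum C) A : R^nat) @ \oo --> u -> r = 1 \/ density A = Dens x ->
  density (transfer C E @` A) = Dens (r * u + x * (1 - r)).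
Proof.
move=> iC iC' iE iE' C0 /cvg_density Er Au rx; apply: density_cvg.
rewrite (rel_freq_image A (transferK iE iE' iC iC') (transferK iC iC' iE iE')).
have Er' := cvg_avgC Er.
rewrite (funext (avg_transfer E C A)) mulrC.
apply: cvgD; first by apply: cvgM => //; exact: (cvg_comp _ _ (cvg_rank iE) Au).
case: rx => [r1|/cvg_density Ax]; last first.
  apply: cvgM => //.
  exact: (cvg_comp _ _ (cvg_rank iE') (cvg_avg_enumC iC iC' C0 Ax)).
rewrite r1 subrr mulr0; rewrite r1 subrr in Er'.
apply: squeeze_cvgr (cvg_cst 0) Er'; near=> n.
by rewrite mulr_ge0 ?avg_ge0//= ler_piMl ?avg_ge0 ?avg_le1.
Unshelve. all: by end_near. Qed.

Lemma exists_shift (r : R) : 0 < r <= 1 -> forall B, infinite_set B ->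
  exists p : Sym, forall A (x : R), r = 1 \/ density A = Dens x ->
  (finite_set (B `\` A) ->
     density (sval p @` A) = Dens (r + x * (1 - r))) /\
  (finite_set (B `&` A) -> density (sval p @` A) = Dens (x * (1 - r))).
Proof.
move=> /andP[r0 r1] B iB; have [C [CB iC iC' C0]] := null_subset iB.
have rall : all_densities (Dens r) by left; exists r; rewrite //= in_itv/= ltW.
have [E [iE iE' Er _]] :=
  exists_densities (fun=> erefl : id _ = _) (fun=> erefl) rall.
have bij : bijective (transfer C E).
  by exists (transfer E C); exact: transferK.
exists (exist _ _ bij) => A x rx /=; split=> [BA|BA].
  by rewrite (density_transfer iC iC' iE iE' C0 Er (cvg_avg_enum1 iC CB BA) rx) mulr1.
by rewrite (density_transfer iC iC' iE iE' C0 Er (cvg_avg_enum0 iC CB BA) rx)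
  mulr0 add0r.
Qed.

End relative_density.

(** * The reduction *)

(** Both alternatives of the theorem are instances, with [r = 1] for the first
one. A single [r] has to serve all [A], because the permutation may depend on
[B] only. *)
Lemma tukey_of_shifts (R : realType) (X Y : set (density_value R))
    (Xall : X `<=` all_densities) (Yall : Y `<=` all_densities)
    (X0 : X !=set0) (XY : forall x, X x -> exists2 y, Y y & y <> x) (r : R) :
  0 < r <= 1 ->
  (forall v, X v -> exists2 x : R, r = 1 \/ v = Dens x &
    [/\ Y (Dens (r + x * (1 - r))), Y (Dens (x * (1 - r))),
        Dens (r + x * (1 - r)) <> v & Dens (x * (1 - r)) <> v]) ->
  density_system Xall Yall X0 XY <=T ur_system.
Proof.
move=> r01 hX.
exists (fun A => exist _ (sval A) (let: And3 iA _ _ := svalP A in iA)).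
pose shift (B : infinite_subset) := cid (exists_shift r01 (svalP B)).
exists (fun B => sval (shift B)) => -[A [iA iA' XA]] B /=.
have [x rx [Y1 Y0 n1 n0]] := hX _ XA.
have [h1 h0] := svalP (shift B) A x rx.
by rewrite /density_rel/= => -[/h1 ->|/h0 ->].
Qed.

Theorem theorem26 (R : realType) (X Y : set (density_value R))
    (Xall : X `<=` all_densities) (Yall : Y `<=` all_densities)
    (X0 : X !=set0)
    (XY : forall x, X x -> exists2 y, Y y & y <> x)
    (zeroX : ~ X (Dens 0)) (oneX : ~ X (Dens 1))
    (cases : (Y (Dens 0) /\ Y (Dens 1)) \/
      (~ X Osc /\
       exists2 r : R, 0 < r <= 1 &
         forall x : R, X (Dens x) ->
           Y (Dens (r + x * (1 - r))) /\ Y (Dens (x * (1 - r))))) :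
  density_system Xall Yall X0 XY <=T ur_system.
Proof.
case: cases => [[Y0 Y1]|[XOsc [r /andP[r0 r1] Yr]]].
  apply: (@tukey_of_shifts R X Y _ _ _ _ 1); first by rewrite ltr01 lexx.
  move=> v Xv; exists 0; first by left.
  by rewrite mul0r addr0; split=> // vE; [apply: oneX|apply: zeroX]; rewrite vE.
apply: (@tukey_of_shifts R X Y _ _ _ _ r); first by rewrite r0 r1.
move=> [x|//] Xx; exists x; first by right.
have [Y1 Y0] := Yr _ Xx; split=> // -[] xE.
  apply: oneX; suff <- : x = 1 by [].
  have : r * (1 - x) = 0 by lra.
  by move/eqP; rewrite mulf_eq0 gt_eqF//= subr_eq0 => /eqP.
apply: zeroX; suff <- : x = 0 by [].
have : r * x = 0 by lra.
by move/eqP; rewrite mulf_eq0 gt_eqF//= => /eqP.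
Qed.
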